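(* If $T$ is a tree with $n$ vertices that is not a path, then $c_k(T)\le n-1$ for every integer $k\ge 4$. Moreover, for pathy classes of trees this bound is tight up to sublinear error: for every pathy class $\Sigma$ of trees, every integer $k\ge 4$ and every $\eta>0$, there is $N$ such that every non-path $T\in\Sigma$ with $n\ge N$ vertices satisfies $c_k(T)\ge n-1-\eta n$.
   Context: All graphs are finite and simple. A class of graphs is an infinite family of (pairwise non-isomorphic) graphs. A class $\Sigma$ of trees is pathy if its $n$-vertex members have $o(n)$ vertices of degree at least $3$, i.e. for every $\delta>0$ there is $N$ such that every $T\in\Sigma$ with $n\ge N$ vertices has at most $\delta n$ vertices of degree at least $3$. Let $G$ be a graph and $k\ge 2$ an integer. A multiset $\mathscr{P}$ of paths in $G$ is a $k$-rainbow separating path system ($k$-RSPS) if its elements can be colored with (at most) $k$ colors so that for every pair of distinct edges $e_1,e_2\in E(G)$ there exist paths $P_1,P_2\in\mathscr{P}$ of distinct colors such that $P_1$ contains $e_1$ but not $e_2$, and $P_2$ contains $e_2$ but not $e_1$. The $k$-rainbow separation number $c_k(G)$ is the smallest cardinality (with multiplicity) of a $k$-RSPS of $G$. *)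

(* Defs.v *)
From HB Require Import structures.
From mathcomp Require Import all_boot all_order all_algebra.
From mathcomp Require Import boolp classical_sets cardinality reals.

Set Implicit Arguments.
Unset Strict Implicit.
Unset Printing Implicit Defensive.

Record sgraph := SGraph {
  vertex :> finType;
  adj : rel vertex;
  adj_sym : symmetric adj;
  adj_irrefl : irreflexive adj }.

Definition iso (G H : sgraph) : Prop :=
  exists2 f : G -> H, bijective f & forall x y : G, adj (f x) (f y) = adj x y.

Section Graph.
Variable G : sgraph.

Definition edges : {set {set G}} :=
  [set [set x; y] | x in G, y in G & adj x y].

Definition degree (x : G) : nat := #|[set y | adj x y]|.

(* The empty graph is not connected. *)
Definition connected : bool :=
  (0 < #|G|) && [forall x : G, forall y : G, connect (@adj G) x y].

(* The length condition excludes [:: x; y], which is a ucycle for an edge xy. *)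
Definition acyclic : Prop :=
  forall c : seq G, ucycle (@adj G) c -> size c <= 2.

Definition tree : Prop := connected /\ acyclic.

(* A path is represented by its nonempty sequence of vertices, in one of its
   two orders. Single-vertex paths are allowed. *)
Definition gpath (p : seq G) : bool :=
  if p is x :: q then path (@adj G) x q && uniq p else false.

Definition path_edges (p : seq G) : seq {set G} :=
  [seq [set xy.1; xy.2] | xy <- zip p (behead p)].

Definition path_graph : Prop :=
  exists p : seq G,
    [/\ gpath p, (forall x : G, x \in p) & edges =i path_edges p].

(* A multiset of paths is a sequence (the order is irrelevant below). Since the
   coloring is indexed by positions, copies of one path may differ in color. *)
Definition RSPS (k : nat) (P : seq (seq G)) : Prop :=
  all gpath P /\
  exists col : 'I_(size P) -> 'I_k,
    forall e1 e2 : {set G}, e1 \in edges -> e2 \in edges -> e1 != e2 ->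
    exists i j : 'I_(size P),
      let P1 := nth [::] P i in
      let P2 := nth [::] P j in
      [/\ col i != col j,
          e1 \in path_edges P1, e2 \notin path_edges P1,
          e2 \in path_edges P2 & e1 \notin path_edges P2].

Definition is_rsn (k m : nat) : Prop :=
  (exists2 P, RSPS k P & size P = m) /\
  (forall P, RSPS k P -> m <= size P).

(* The default 0 is never used for k >= 2: see rsnP. *)
Definition rsn (k : nat) : nat := xget 0 (is_rsn k).

Lemma RSPS_exists k : 2 <= k -> exists P, RSPS k P.
Proof.
move=> k2.
pose A := [seq xy <- enum {: G * G} | adj xy.1 xy.2].
pose L := [seq ([:: xy.1; xy.2], c) | xy <- A, c <- enum 'I_k].
pose c0 : 'I_k := Ordinal (ltnW k2); pose c1 : 'I_k := Ordinal k2.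
have LP x y c : adj x y -> ([:: x; y], c) \in L.
  move=> xy; apply/allpairsP; exists ((x, y), c).
  by split=> /=; [rewrite mem_filter xy mem_enum | rewrite mem_enum |].
have szL : size (unzip1 L) = size L by rewrite size_map.
exists (unzip1 L); split.
  apply/allP => p /mapP [[q c] /allpairsP [[[x y] c'] [/= + _ [-> _]]] ->] /=.
  rewrite mem_filter /= => /andP[xy _]; rewrite xy /= inE andbT.
  by apply: contraTneq xy => ->; rewrite adj_irrefl.
exists (fun i => (nth ([::], c0) L i).2) => e1 e2.
move=> /imset2P [x1 y1 _ /[!inE] /= a1 ->] /imset2P [x2 y2 _ /[!inE] /= a2 ->].
move=> ne.
have l1 := LP _ _ c0 a1; have l2 := LP _ _ c1 a2.
have i1 : index ([:: x1; y1], c0) L < size (unzip1 L) by rewrite szL index_mem.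
have i2 : index ([:: x2; y2], c1) L < size (unzip1 L) by rewrite szL index_mem.
exists (Ordinal i1), (Ordinal i2) => /=.
rewrite !(nth_map ([::], c0)) -?szL // !nth_index //=.
by rewrite /path_edges /= !inE eqxx ne eq_sym ne eqxx; split.
Qed.

Lemma rsnP k : 2 <= k -> is_rsn k (rsn k).
Proof.
move=> /RSPS_exists [P0 rP0]; apply: (@xgetPex _ 0 (is_rsn k)).
have ex : exists m, `[< exists2 P, RSPS k P & size P = m >].
  by exists (size P0); apply/asboolP; exists P0.
case: (ex_minnP ex) => m /asboolP hm min; exists m; split=> // P rP.
by apply: min; apply/asboolP; exists P.
Qed.

End Graph.

(* A class is an indexed family; set sgraph would be universe-inconsistent. *)
Definition graph_class (I : Type) (Sigma : I -> sgraph) : Prop :=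
  infinite_set [set: I]%classic /\
  forall i j : I, i <> j -> ~ iso (Sigma i) (Sigma j).

Definition tree_class (I : Type) (Sigma : I -> sgraph) : Prop :=
  graph_class Sigma /\ forall i : I, tree (Sigma i).

Definition pathy (R : realType) (I : Type) (Sigma : I -> sgraph) : Prop :=
  forall delta : R, (0 < delta)%R ->
  exists N : nat, forall i : I, N <= #|Sigma i| ->
    (#|[set x : Sigma i | (3 <= degree x)%N]|%:R <= delta * #|Sigma i|%:R)%R.

(* Main.v *)
Require Import Defs.
From mathcomp Require Import all_boot all_order all_algebra.
From mathcomp Require Import boolp classical_sets cardinality reals.
From mathcomp Require Import fintype finset zify lra.

Set Implicit Arguments.
Unset Strict Implicit.
Unset Printing Implicit Defensive.

(** A tree that is not a path has a vertex [r] of degree at least 3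
    ([nonpath_branch]); both bounds are organised around such a vertex.

    Upper bound.  One path is built for each vertex other than [r], so that
    there are [#|T| - 1] of them.  In the star at [r], with leaves
    x_0, ..., x_(m-1) and m >= 3, these are the paths x_i r x_(i+1) with cyclic
    indices; each edge lies on two of them, and four colors suffice
    ([cyc_color_separates], [star_system]).  The remaining vertices are then
    attached one at a time.  To attach [l] to a vertex [u] of the part built so
    far, a path A that ends at [u] is prolonged to [l] and the one-edge path
    [u l] is added with a new color c ([system_grow]).  If A has at most two
    edges before the prolongation, c can avoid the color of A and, for each edge
    of A, the color of some other path through that edge: at most three colors.
    This keeps all edges separated.  To guarantee a short path ending at [u],
    every vertex other than [r] reserves a path that ends there, in such a way
    that edges plus reservations never exceed three on any path; prolonging A
    trades the reservation of [u] for an edge, and the new path has room for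
    the reservations of both [u] and [l].

    Lower bound.  The number of paths is at least the number of vertices of
    degree at most 2 ([low_degree_le_size]), which for a pathy class is
    n - o(n).  A path has at most two ends, so it suffices to count two ends per
    vertex of degree at most 2.  At a vertex of degree 2, separating its two
    edges makes one path end there from each side.  At a leaf, all the paths
    through its edge end, but there may be only one of them.  In that case it
    consists of this edge alone, and its other end lies at the neighbor.  The
    missing end is passed on in this way toward the root [r]: an edge lying on a
    single path owes one end to its child, and the debt is repaid at the parent
    if that has degree at least 3 and is otherwise either repaid or passed on
    ([ends_local]).  Summing over all vertices, the debts cancel. *)

(** * Paths and growing trees *)

Section Paths.
Variable T : sgraph.
Implicit Types (x y u v w : T) (p q : seq T) (S : {set T}).

Lemma gpath_cons2 x y p :
  gpath [:: x, y & p] = [&& adj x y, x \notin y :: p & gpath (y :: p)].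
Proof. by rewrite /gpath [path _ x _]/= cons_uniq -andbA; congr andb; rewrite andbCA. Qed.

Lemma set2_inj x y u v : [set x; y] = [set u; v] ->
  (x = u /\ y = v) \/ (x = v /\ y = u).
Proof.
move=> E.
have : x \in [set u; v] by rewrite -E set21.
have : y \in [set u; v] by rewrite -E set22.
have : u \in [set x; y] by rewrite E set21.
have : v \in [set x; y] by rewrite E set22.
rewrite !in_set2 => /orP[]/eqP h1 /orP[]/eqP h2 /orP[]/eqP h3 /orP[]/eqP h4;
  by [left; split; congruence | right; split; congruence].
Qed.

Lemma path_edges_cons2 x y p :
  path_edges [:: x, y & p] = [set x; y] :: path_edges (y :: p).
Proof. by []. Qed.

Lemma path_edges_sub p x y :
  [set x; y] \in path_edges p -> x \in p /\ y \in p.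
Proof.
elim: p => [|a [|b p] IH] //; rewrite path_edges_cons2 inE.
case/orP=> [/eqP/set2_inj[[-> ->]|[-> ->]]|/IH[xp yp]].
- by rewrite !inE !eqxx ?orbT.
- by rewrite !inE !eqxx ?orbT.
- by split; rewrite inE ?xp ?yp orbT.
Qed.

Lemma path_edges_rcons2 p x y :
  path_edges (rcons (rcons p x) y) = rcons (path_edges (rcons p x)) [set x; y].
Proof.
elim: p => [|a [|b p] IH] //.
by rewrite !rcons_cons !path_edges_cons2 -!rcons_cons IH.
Qed.

Lemma path_edges_rev p : path_edges (rev p) =i path_edges p.
Proof.
elim: p => [|a [|b p] IH] //.
move=> e; rewrite 2!rev_cons path_edges_rcons2 -rev_cons mem_rcons inE IH.
by rewrite path_edges_cons2 inE setUC.
Qed.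

Lemma gpath_rev p : gpath p -> gpath (rev p).
Proof.
case: p => [|x p] //= /andP[pp up].
have -> : rev (x :: p) = last x p :: rev (belast x p) by rewrite lastI rev_rcons.
rewrite /gpath rev_path; apply/andP; split.
  by rewrite (eq_path (e' := @adj T)) // => a b; rewrite adj_sym.
by rewrite -rev_rcons -lastI rev_uniq.
Qed.

Lemma mem_edges x y : ([set x; y] \in edges T) = adj x y.
Proof.
apply/imset2P/idP => [[a b _ /[!inE] /= ab /set2_inj[[-> ->]|[-> ->]]]|xy] //.
  by rewrite adj_sym.
by exists x y; rewrite ?inE.
Qed.

Lemma edgesP e : reflect (exists x y, adj x y /\ e = [set x; y]) (e \in edges T).
Proof.
apply: (iffP idP) => [/imset2P[x y _ /[!inE] /= xy ->]|[x [y [xy ->]]]].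
  by exists x, y.
by rewrite mem_edges.
Qed.

Lemma gpath_edges p e : gpath p -> e \in path_edges p -> e \in edges T.
Proof.
elim: p => [|a [|b p] IH] //; rewrite gpath_cons2 => /and3P[ab _ /IH{}IH].
by rewrite path_edges_cons2 inE => /orP[/eqP->|/IH//]; rewrite mem_edges.
Qed.

Definition endpoint p v := if p is x :: q then (v == x) || (v == last x q) else false.

Lemma endpoint_rev p v : endpoint (rev p) v = endpoint p v.
Proof.
case: p => [|x p] //; case/lastP: p => [|p y] //.
by rewrite -rcons_cons rev_rcons rev_cons /= !last_rcons orbC.
Qed.

(** This is what forces a path to end at a vertex: it uses two edges at each of
    its other vertices. *)
Lemma inner_edges p v : gpath p -> v \in p -> ~~ endpoint p v ->
  exists a b, [/\ a != b, [set v; a] \in path_edges p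
                        & [set v; b] \in path_edges p].
Proof.
elim: p => [|x p IH] // gp; rewrite inE /= negb_or.
case: eqP => //= _ vp vl.
case: p IH gp vp vl => // y p IH gp vp vl.
have [vy|vy] := eqVneq v y.
  case: p vy {IH} gp {vp} vl => [|z p] vy /=; first by rewrite vy eqxx.
  rewrite !inE !negb_or => /andP[_ /andP[/and3P[_ xz _] _]] _; exists x, z.
  by rewrite xz !path_edges_cons2 !inE -vy setUC !eqxx ?orbT.
have gp' : gpath (y :: p) by move: gp; rewrite gpath_cons2 => /and3P[].
have [||a [b [ab va vb]]] := IH gp' => //; first by rewrite /= negb_or vy.
by exists a, b; rewrite path_edges_cons2 !inE va vb !orbT.
Qed.

(** A path may be traversed from either end, so that prolonging it at any
    endpoint amounts to adding a vertex in front. *)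
Lemma path_to_endpoint p u : gpath p -> endpoint p u -> exists q,
  [/\ gpath (u :: q), path_edges (u :: q) =i path_edges p,
      size (u :: q) = size p, u :: q =i p & endpoint (u :: q) =1 endpoint p].
Proof.
case: p => [|x p] // gp; rewrite {1}/endpoint => /orP[/eqP->|/eqP->]; first by exists p.
have E : rev (x :: p) = last x p :: rev (belast x p) by rewrite lastI rev_rcons.
exists (rev (belast x p)); rewrite -E; split=> [||| |].
- exact: gpath_rev.
- exact: path_edges_rev.
- by rewrite size_rev.
- by move=> z; rewrite mem_rev.
- exact: endpoint_rev.
Qed.

Definition edges_in S := [set e in edges T | e \subset S].

(** Connectedness of the induced subgraph; [S] may be empty. *)
Definition linked S :=
  {in S &, forall x y, connect [rel a b | [&& adj a b, a \in S & b \in S]] x y}.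

Lemma linked_sym S : connect_sym [rel a b | [&& @adj T a b, a \in S & b \in S]].
Proof.
by apply: sym_connect_sym => a b /=; rewrite adj_sym (andbC (a \in S)).
Qed.

Lemma linked_star r : linked (r |: [set x | adj r x]).
Proof.
set S := _ |: _.
have toR x : x \in S -> connect [rel a b | [&& adj a b, a \in S & b \in S]] r x.
  move=> xS; have := xS; rewrite !inE => /orP[/eqP->|rx]; first exact: connect0.
  by apply: connect1; rewrite /= rx xS !inE eqxx.
move=> x y /toR cx /toR cy; apply: connect_trans cy; by rewrite linked_sym.
Qed.

Lemma linked_grow S u l : linked S -> u \in S -> adj u l -> linked (l |: S).
Proof.
move=> lS uS ul; set S' := _ |: _.
have toU x : x \in S' -> connect [rel a b | [&& adj a b, a \in S' & b \in S']] u x.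
  rewrite !inE => /orP[/eqP->|xS].
    by apply: connect1; rewrite /= ul !inE uS eqxx orbT.
  apply: connect_sub (lS _ _ uS xS) => a b /and3P[ab aS bS].
  by apply: connect1; rewrite /= ab !inE aS bS !orbT.
move=> x y /toU cx /toU cy; apply: connect_trans cy; by rewrite linked_sym.
Qed.

(** Two edges from [l] into a connected part would close a cycle through [l]. *)
Lemma attach_uniq S u u' l : acyclic T -> linked S -> l \notin S ->
  u \in S -> u' \in S -> adj u l -> adj u' l -> u' = u.
Proof.
move=> acT lS lNS uS u'S ul u'l.
have /connectP[p0 pp0] := lS _ _ uS u'S.
case/shortenP: pp0 => p pp up _ E.
have pS : {subset p <= S}.
  move=> x; elim: p u pp {up uS ul E} => //= b p IH a /andP[/and3P[_ _ bS] pp].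
  by rewrite inE => /orP[/eqP->|/IH]; [|apply; exact: pp].
have /acT : ucycle (@adj T) [:: l, u & p].
  rewrite /ucycle /cycle /= rcons_path /= -E u'l (adj_sym l) ul /= andbT.
  rewrite (sub_path _ pp) /=; last by move=> a b /and3P[].
  rewrite -cons_uniq cons_uniq up andbT inE negb_or.
  by rewrite (contraNneq _ lNS) => [/=|->//]; apply: contra lNS => /pS.
by case: p E {pp up pS} => //=.
Qed.

Lemma edges_in_grow S u l : u \in S -> adj u l ->
  (forall u', u' \in S -> adj u' l -> u' = u) ->
  edges_in (l |: S) = [set u; l] |: edges_in S.
Proof.
move=> uS ul un; apply/setP => e; rewrite in_setU1 !in_set.
apply/idP/idP => [/andP[/edgesP[x [y [xy ->]]]]|].
  rewrite subUset !sub1set !in_setU1 mem_edges xy subUset !sub1set /=.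
  case/andP=> /orP[/eqP xl|xS] /orP[/eqP yl|yS].
  - by rewrite xl yl adj_irrefl in xy.
  - by rewrite -(un y yS) -?xl ?(adj_sym y) // setUC eqxx.
  - by rewrite -(un x xS) -?yl // eqxx.
  - by rewrite xS yS orbT.
case/orP=> [/eqP->|/andP[-> eS]].
  by rewrite mem_edges ul subUset !sub1set !inE uS eqxx orbT.
by rewrite (subset_trans eS) ?subsetU1.
Qed.

(** Any connected part of a connected graph can be completed to the whole graph
    by attaching one vertex at a time to the part already present. *)
Lemma grow_ind (Q : {set T} -> Prop) S0 : connected T -> S0 != set0 -> linked S0 ->
  (forall S u l, linked S -> S0 \subset S -> u \in S -> l \notin S -> adj u l ->
     Q S -> Q (l |: S)) ->
  Q S0 -> Q [set: T].
Proof.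
move=> /andP[_ /forallP cT] /set0Pn[s0 s0S] lS0 step QS0.
have [n] := ubnP #|~: S0|.
suff H S : #|~: S| < n -> linked S -> S0 \subset S -> Q S -> Q [set: T].
  by move=> /H; apply.
elim: n S => // n IH S ltn lS S0S QS.
have [<-//|] := eqVneq S [set: T]; rewrite eqEsubset subsetT /= => /subsetPn[x _ xS].
have sS := subsetP S0S _ s0S.
have [u [l [uS lS' ul]]] : exists u l, [/\ u \in S, l \notin S & adj u l].
  have /connectP[p pp E] := forallP (cT s0) x; rewrite {x}E in xS.
  elim: p s0 sS pp xS {s0S} => /= [s -> //|b p IHp a aS /andP[ab pp] xS].
  have [bS|bS] := boolP (b \in S); first exact: IHp pp xS.
  by exists a, b.
apply: (IH (l |: S)).
- rewrite ltnS in ltn; apply: leq_trans ltn; apply: proper_card.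
  by rewrite setCU setIC -setDE properD1 // inE.
- exact: linked_grow ul.
- exact: subset_trans S0S (subsetU1 _ _).
- exact: step ul QS.
Qed.

(** If all degrees are at most 2, a growing tree stays a path: a new vertex can
    only be attached at an endpoint, since an inner vertex already has two
    neighbors on the path. *)
Lemma nonpath_branch : tree T -> ~ path_graph T -> exists r : T, 3 <= degree r.
Proof.
move=> [cT aT] npT; apply: contrapT => nbr; apply: npT.
have dg v : degree v <= 2 by rewrite leqNgt; apply/negP => h; apply: nbr; exists v.
have /card_gt0P[s _] : 0 < #|T| by case/andP: cT.
have l1 : linked [set s].
  by move=> x y /set1P-> /set1P->; exact: connect0.
suff [p [gp pT eT]] : exists p, [/\ gpath p, p =i [set: T] & edges_in [set: T] =i path_edges p].
  exists p; split=> // [x|e]; first by rewrite pT inE.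
  by rewrite -eT inE subsetT andbT.
apply: (grow_ind (Q := fun S => exists p, [/\ gpath p, p =i S & edges_in S =i path_edges p]) cT _ l1).
- by apply/set0Pn; exists s; rewrite set11.
- move=> S u l lS _ uS lNS ul [p [gp pS eS]].
  have up : endpoint p u.
    apply/idPn => nu; have [|a [b [ab ua ub]]] := inner_edges gp _ nu; first by rewrite pS.
    have := dg u; rewrite leqNgt => /negP; apply.
    have: uniq [:: a; b; l].
      have [_ aS] := path_edges_sub ua; have [_ bS] := path_edges_sub ub.
      rewrite /= !inE negb_or ab andbT /=; apply/andP.
      by split; apply: contraNneq lNS => <-; rewrite -pS.
    move/card_uniqP => /= <-; apply: subset_leq_card; apply/subsetP => x.
    rewrite !inE => /or3P[]/eqP-> //; rewrite -mem_edges;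
      exact: gpath_edges gp _.
  have [q [gq eq sq mq _]] := path_to_endpoint gp up.
  exists (l :: u :: q); split.
  + by rewrite gpath_cons2 adj_sym ul mq pS lNS.
  + by move=> x; rewrite inE mq pS !inE.
  + move=> e; rewrite (edges_in_grow uS ul); last first.
      by move=> u' u'S; exact: attach_uniq lS lNS uS u'S ul.
    by rewrite in_setU1 path_edges_cons2 in_cons eq eS (setUC [set u]).
- exists [:: s]; split=> // [x|e]; first by rewrite !inE.
  rewrite inE; apply/negbTE/negP => /andP[/edgesP[x [y [xy ->]]]].
  rewrite subUset !sub1set !inE => /andP[/eqP xs /eqP ys].
  by rewrite xs ys adj_irrefl in xy.
Qed.

End Paths.

(** * Coloring the paths of a star *)

Definition cyc_next m i := if i.+1 == m then 0 else i.+1.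
(** Colors 0, 1, 2 repeat on the largest multiple of three, and the at most two
    remaining indices receive color 3.  Then indices at cyclic distance two have
    different colors, and at most one pair of consecutive indices shares its
    color.  Consecutive indices cannot always be given different colors as well:
    for m = 5 this would take five colors. *)
Definition cyc_color m i := if i < 3 * (m %/ 3) then i %% 3 else 3.
(** The path number [p] joins the edges number [p] and [cyc_next m p] of a star with
    [m] edges. *)
Definition cyc_incident m p i := (p == i) || (cyc_next m p == i).

(** The edge [i] lies on the paths [i] and [i - 1].  If [i] and [j] are
    consecutive they share one path, and their other paths are at distance two,
    hence of different colors.  Otherwise any of the four choices of paths is
    admissible; they could fail only if both edges had their two paths in one
    and the same color, which happens for at most one edge. *)
Lemma cyc_color_separates m i j : 2 < m -> i < m -> j < m -> i != j ->
  exists p q, [/\ p < m, q < m, cyc_color m p != cyc_color m q,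
    (cyc_incident m p i && ~~ cyc_incident m p j) & (cyc_incident m q j && ~~ cyc_incident m q i)].
Proof.
move=> m2 im jm ij.
pose pr x := if x == 0 then m.-1 else x.-1.
have [t [tm mt t3 colE]] : exists t, [/\ 2 < t <= m, m < t + 3, t %% 3 = 0
    & forall x, cyc_color m x = if x < t then x %% 3 else 3].
  exists (3 * (m %/ 3)); split=> //; lia.
have dist2 x : x < m -> cyc_color m (pr x) != cyc_color m (cyc_next m x).
  rewrite !colE /cyc_next /pr => xm.
  have [->|x0] := eqVneq x 0; have [xe|xe] := eqVneq x.+1 m; repeat case: ifP; lia.
have mono x : x < m -> cyc_color m (pr x) = cyc_color m x -> x = m.-1.
  by rewrite !colE /pr => xm; repeat case: ifP; lia.
have pr_next x : x < m -> (pr x == cyc_next m x) = false.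
  by rewrite /cyc_next /pr => xm; repeat case: ifP; lia.
have prm x : x < m -> pr x < m by rewrite /pr; case: ifP; lia.
have prK x : x < m -> cyc_next m (pr x) = x by rewrite /cyc_next /pr; repeat case: ifP; lia.
have : [|| (cyc_color m i != cyc_color m j) && (cyc_next m i != j) && (cyc_next m j != i),
  (cyc_color m i != cyc_color m (pr j)) && (pr j != i) && (cyc_next m i != j),
  (cyc_color m (pr i) != cyc_color m j) && (pr i != j) && (cyc_next m j != i) |
  (cyc_color m (pr i) != cyc_color m (pr j)) && (pr i != j) && (pr j != i)].
  have prE x y : x < m -> y < m -> (pr y == x) = (cyc_next m x == y).
    by rewrite /cyc_next /pr => xm ym; repeat case: ifP; lia.
  rewrite !prE //.
  have [ji|nji] := eqVneq (cyc_next m i) j.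
    have := pr_next i im; have := dist2 i im.
    by rewrite ji prE // => -> ->; rewrite !orbT.
  have [ij'|nij'] := eqVneq (cyc_next m j) i.
    by have := dist2 j jm; rewrite ij' eq_sym => ->; rewrite /= orbT.
  rewrite !andbT; apply/idPn; rewrite !negb_or !negbK => /and4P[/eqP a /eqP b /eqP c /eqP d].
  by move: ij; rewrite (mono i im) ?a // (mono j jm) ?eqxx // -b.
have cc1 x : cyc_incident m x x by rewrite /cyc_incident eqxx.
have cc2 x : x < m -> cyc_incident m (pr x) x by move=> xm; rewrite /cyc_incident prK // eqxx orbT.
have nc1 x y : x != y -> cyc_next m x != y -> ~~ cyc_incident m x y.
  by move=> xy n; rewrite /cyc_incident negb_or xy n.
have nc2 x y : x < m -> x != y -> pr x != y -> ~~ cyc_incident m (pr x) y.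
  by move=> xm xy n; rewrite /cyc_incident negb_or prK // n xy.
have ji : j != i by rewrite eq_sym.
have [pi pj] := (prm i im, prm j jm).
case/or4P => /andP[/andP[c n1] n2].
- by exists i, j; rewrite !cc1 !nc1.
- by exists i, (pr j); split; rewrite ?cc1 ?cc2 ?nc2 ?nc1 //.
- by exists (pr i), j; split; rewrite ?cc1 ?cc2 ?nc2 ?nc1 //.
- by exists (pr i), (pr j); split; rewrite ?cc2 ?nc2 //.
Qed.

(** * Extending a path system by a leaf *)

Section System.
Variables (T : sgraph) (r : T).
Implicit Types (u v w : T) (S : {set T}) (e : {set T}).

Definition separated S (P : T -> seq T) (col : T -> 'I_4) e1 e2 :=
  exists v w, [/\ v \in S :\ r, w \in S :\ r, col v != col w,
    (e1 \in path_edges (P v)) && (e2 \notin path_edges (P v)) &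
    (e2 \in path_edges (P w)) && (e1 \notin path_edges (P w))].

Lemma separatedC S P col e1 e2 :
  separated S P col e1 e2 -> separated S P col e2 e1.
Proof. by move=> [v [w [? ? ? ? ?]]]; exists w, v; rewrite eq_sym. Qed.

(** The invariant of the construction: the path [P v] is indexed by a vertex [v]
    of [S] other than [r], and [A u] is the index of the path reserved by [u].
    The second clause, applied with a path through [e], yields a second one.
    In the last clause [size (P v)] counts vertices, so that the bound 4 means
    that edges plus reservations do not exceed three. *)
Definition system S (P : T -> seq T) (col : T -> 'I_4) (A : T -> T) : Prop :=
  [/\ forall v, v \in S :\ r -> gpath (P v) /\ {subset P v <= S},
      forall e v, e \in edges_in S ->
        exists w, [/\ w \in S :\ r, w != v & e \in path_edges (P w)],
      forall e1 e2, e1 \in edges_in S -> e2 \in edges_in S -> e1 != e2 ->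
        separated S P col e1 e2,
      forall u, u \in S :\ r -> A u \in S :\ r /\ endpoint (P (A u)) u
    & forall v, v \in S :\ r -> #|[set w in S :\ r | A w == v]| + size (P v) <= 4].

Lemma fresh_color (s : seq 'I_4) : size s <= 3 -> exists c, c \notin s.
Proof.
move=> ss; apply: contrapT => h.
have : #|'I_4| <= size s.
  apply: leq_trans (card_size s); apply: subset_leq_card; apply/subsetP => c _.
  by apply/idPn => cs; apply: h; exists c.
by rewrite card_ord ltnNge in ss *; rewrite ss.
Qed.

(** The new edge [u l] lies on the prolonged path and on the new one.  An old
    edge [e] has a further path [other e]; it is separated from [u l] by this
    path and the new one if their colors differ.  If they agree, [e] is not on
    the reserved path, by the choice of the new color, and the prolonged path
    takes the place of the new one. *)
Lemma system_grow S P col A u l : acyclic T -> linked S -> r \in S ->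
  u \in S -> l \notin S -> adj u l -> u != r ->
  system S P col A -> exists P' col' A', system (l |: S) P' col' A'.
Proof.
move=> acT lS rS uS lNS ul ur [gP cov sep srv cap].
have uI : u \in S :\ r by rewrite !inE ur.
have [v0I eu] := srv u uI; set v0 := A u in v0I eu.
have [gp0 p0S] := gP v0 v0I.
have [q [gq eq sq mq endq]] := path_to_endpoint gp0 eu.
(* The reservation of [u] leaves room for at most two edges on its path. *)
have sz0 : size (u :: q) <= 3.
  rewrite sq -ltnS; apply: leq_trans (cap v0 v0I).
  rewrite -add1n leq_add2r; apply/card_gt0P; exists u.
  by rewrite inE uI eqxx.
have lr : l != r by apply: contraNneq lNS => ->.
have lI v : v \in S :\ r -> v != l.
  by rewrite in_setD1 => /andP[_ vS]; apply: contraNneq lNS => <-.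
have lv0 := lI _ v0I.
have S'I v : (v \in (l |: S) :\ r) = (v == l) || (v \in S :\ r).
  by rewrite !inE; have [->|] := eqVneq v l; rewrite ?lr.
have edE : edges_in (l |: S) = [set u; l] |: edges_in S.
  by apply: edges_in_grow => // u' u'S; exact: attach_uniq lS lNS uS u'S ul.
have fN e : e \in edges_in S -> e != [set u; l].
  rewrite inE => /andP[_ /subsetP eS]; apply: contraNneq lNS => ef.
  by apply: eS; rewrite ef set22.
(* The default [r] is not used: by [cov] such a path exists for old edges. *)
pose other e := odflt r
  [pick w | [&& w \in S :\ r, w != v0 & e \in path_edges (P w)]].
have otherP e : e \in edges_in S ->
    [/\ other e \in S :\ r, other e != v0 & e \in path_edges (P (other e))].
  move=> eS; rewrite /other; case: pickP => [w /and3P[]//|no].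
  by have [w [wI wv0 ew]] := cov e v0 eS; have := no w; rewrite wI wv0 ew.
have [c] : exists c, c \notin col v0 :: [seq col (other e) | e <- path_edges (u :: q)].
  apply: fresh_color; rewrite /= size_map size_map size_zip /=.
  by move: sz0 => /=; case: (size q) => [|[|[|]]] //.
rewrite in_cons negb_or => /andP[cv0 /negP cother].
pose P' v := if v == l then [:: u; l] else if v == v0 then l :: u :: q else P v.
pose col' v := if v == l then c else col v.
pose A' w := if (w == l) || (w == u) then l else A w.
have P'l : P' l = [:: u; l] by rewrite /P' eqxx.
have P'v0 : P' v0 = l :: u :: q by rewrite /P' (negPf lv0) eqxx.
have oldE v e : e \in edges_in S ->
    (e \in path_edges (P' v)) = (v != l) && (e \in path_edges (P v)).
  move=> /fN eN; rewrite /P'; case: eqP => [_|_] /=.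
    by rewrite path_edges_cons2 in_cons (negPf eN).
  case: eqP => [->|_] //.
  by rewrite path_edges_cons2 in_cons (setUC [set l]) (negPf eN) eq.
have newE v : v \in (l |: S) :\ r ->
    ([set u; l] \in path_edges (P' v)) = (v == l) || (v == v0).
  rewrite S'I /P'; case: eqP => [_ _|_] /=; first by rewrite path_edges_cons2 in_cons eqxx.
  move=> vI; case: eqP => [_|_] /=; first by rewrite path_edges_cons2 in_cons setUC eqxx.
  apply/negP => /path_edges_sub[_ lP].
  by have [_ /(_ _ lP)] := gP v vI; apply/negP.
have lI' : l \in (l |: S) :\ r by rewrite S'I eqxx.
have oI v : v \in S :\ r -> v \in (l |: S) :\ r by rewrite S'I => ->; rewrite orbT.
have sepf e : e \in edges_in S -> separated (l |: S) P' col' [set u; l] e.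
  move=> eS; have [oeI oev0 eoe] := otherP e eS.
  have fo : [set u; l] \notin path_edges (P' (other e)).
    by rewrite newE ?oI // negb_or lI.
  have eo : e \in path_edges (P' (other e)) by rewrite oldE // lI.
  have fl : [set u; l] \in path_edges (P' l) by rewrite newE // eqxx.
  have el : e \notin path_edges (P' l) by rewrite oldE // eqxx.
  have [co|co] := eqVneq c (col (other e)).
    exists v0, (other e); rewrite /col' (negPf lv0) (negPf (lI _ oeI)) -co eq_sym cv0.
    rewrite !oI // eo fo newE ?oI // eqxx orbT oldE // lv0 /=.
    split=> //; apply: contraPN co => ev0 co; apply: cother.
    by rewrite co; apply: map_f; rewrite eq.
  by exists l, (other e); rewrite /col' eqxx (negPf (lI _ oeI)) co lI' (oI _ oeI) fl el eo fo.
exists P', col', A'; split.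
- move=> v; rewrite S'I /P'; case: eqP => [_ _|_ /= vI].
    rewrite gpath_cons2 ul /= inE; split.
      by rewrite andbT; apply: contraNneq lNS => <-.
    by move=> x; rewrite !inE => /orP[]/eqP->; rewrite ?eqxx ?uS ?orbT.
  case: eqP => [_|_].
    split; first by rewrite gpath_cons2 adj_sym ul gq andbT mq; apply: contra lNS => /p0S.
    move=> x; rewrite in_cons mq in_setU1 => /orP[->//|/p0S ->]; exact: orbT.
  have [gv vS] := gP v vI; split=> // x /vS xS; by rewrite in_setU1 xS orbT.
- move=> e v; rewrite edE in_setU1 => /orP[/eqP->|eS].
    have [->|vl] := eqVneq v l.
      by exists v0; rewrite newE ?oI // eqxx orbT.
    by exists l; rewrite newE // eqxx eq_sym.
  have [w [wI wv ew]] := cov e v eS; exists w.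
  by rewrite oldE // oI // wv lI.
- move=> e1 e2; rewrite edE !in_setU1.
  move=> /orP[/eqP->|e1S] /orP[/eqP->|e2S] ne.
  + by rewrite eqxx in ne.
  + exact: sepf.
  + by apply: separatedC; exact: sepf.
  have [v [w [vI wI vw h1 h2]]] := sep e1 e2 e1S e2S ne.
  exists v, w; rewrite !oI // /col' (negPf (lI _ vI)) (negPf (lI _ wI)).
  by rewrite !oldE // !lI.
- move=> w; rewrite S'I /A' => wI.
  have [->|wl] := eqVneq w l; first by rewrite lI' P'l /= eqxx orbT.
  have [->|wu] := eqVneq w u; first by rewrite lI' P'l /= eqxx.
  rewrite (negPf wl) /= in wI *; have [AwI ew] := srv w wI; split; first exact: oI.
  rewrite /P' (negPf (lI _ AwI)); case: eqP => // Aw.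
  by move: ew; rewrite Aw -endq /= (negPf wu) /= => ->; rewrite orbT.
move=> v; rewrite S'I => vI.
have [->|vl] := eqVneq v l.
  rewrite P'l /= (leq_add2r 2 _ 2) -[leqRHS]/(1.+1).
  apply: (@leq_trans #|[set u; l]|); last by rewrite cards2; case: (_ != _).
  apply: subset_leq_card; apply/subsetP => w /setIdP[]; rewrite S'I in_set2 /A'.
  case: (w == l); rewrite ?orbT //; case: (w == u) => //= /srv[/lI Aw _].
  by rewrite (negPf Aw).
rewrite (negPf vl) /= in vI.
have sub : [set w in (l |: S) :\ r | A' w == v] \subset
           [set w in S :\ r | A w == v] :\ u.
  apply/subsetP => w /setIdP[]; rewrite S'I /A'.
  have [_|wl] := eqVneq w l; first by rewrite /= (eq_sym l) (negPf vl).
  have [_|wu /= wI Aw] := eqVneq w u; first by rewrite /= (eq_sym l) (negPf vl).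
  by rewrite in_setD1 wu; apply/setIdP; split.
have [vv0|vv0] := eqVneq v v0; last first.
  rewrite /P' (negPf vl) (negPf vv0); apply: leq_trans (cap v vI).
  rewrite leq_add2r; apply: leq_trans (subset_leq_card sub) _.
  by apply: subset_leq_card; apply: subD1set.
rewrite vv0 in sub *; rewrite P'v0 [size _]/= -[(size _).+1]/(size (u :: q)) sq.
apply: leq_trans (cap v0 v0I); rewrite addnS ltn_add2r.
apply: leq_ltn_trans (subset_leq_card sub) _.
by rewrite [in X in _ < X](cardsD1 u) inE uI eqxx.
Qed.
End System.

(** * The upper bound *)

Section Star.
Variables (T : sgraph) (r : T).
Hypotheses (acT : acyclic T) (dr : 3 <= degree r).

(** Each path of the star has two edges and is reserved only by the leaf that
    indexes it. *)
Lemma star_system : exists P col A, system r (r |: [set x | adj r x]) P col A.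
Proof.
set N := [set x | adj r x]; set S := r |: N.
have NE x : (x \in N) = adj r x by rewrite inE.
have rN : r \notin N by rewrite NE adj_irrefl.
have SI : S :\ r = N by rewrite setU1K.
set s := enum N; set m := size s.
have m2 : 2 < m by rewrite /m /s -cardE.
have us : uniq s := enum_uniq N.
have sN x : (x \in s) = (x \in N) by rewrite mem_enum.
have idx x : x \in N -> index x s < m by rewrite -sN -index_mem.
pose x_ i := nth r s i.
have xN i : i < m -> x_ i \in N by move=> im; rewrite -sN mem_nth.
have xK x : x \in N -> x_ (index x s) = x by rewrite -sN => xs; exact: nth_index.
have Kx i : i < m -> index (x_ i) s = i by move=> im; exact: index_uniq.
have cm i : i < m -> cyc_next m i < m by rewrite /cyc_next; case: eqP; lia.
pose P v := [:: v; r; x_ (cyc_next m (index v s))].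
pose col v : 'I_4 := inord (cyc_color m (index v s)).
have edS e : e \in edges_in S -> exists2 i, i < m & e = [set r; x_ i].
  rewrite inE => /andP[/edgesP[x [y [xy ->]]]].
  rewrite subUset !sub1set !in_setU1.
  have key z : z \in N -> exists2 i, i < m & [set r; z] = [set r; x_ i].
    by move=> zN; exists (index z s); rewrite ?idx ?xK.
  case/andP => /orP[/eqP xr|xN'] /orP[/eqP yr|yN'].
  - by rewrite xr yr adj_irrefl in xy.
  - by rewrite xr; exact: key.
  - by rewrite yr setUC; exact: key.
  have /acT // : ucycle (@adj T) [:: r; x; y].
  rewrite /ucycle /= !inE -!NE xN' xy (adj_sym y) -NE yN' /= negb_or andbT -andbA.
  have -> : x != y by apply: contraTneq xy => ->; rewrite adj_irrefl.
  by rewrite andbT; apply/andP; split; apply: contraNneq rN => ->.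
have memP i j : i < m -> j < m ->
    ([set r; x_ i] \in path_edges (P (x_ j))) = cyc_incident m j i.
  move=> im jm; rewrite /P !path_edges_cons2 !in_cons in_nil orbF Kx //.
  have rx k : k < m -> r != x_ k by move/xN => kN; apply: contraNneq rN => ->.
  have eqx k l : k < m -> l < m -> ([set r; x_ k] == [set r; x_ l]) = (l == k).
    move=> km lm; apply/eqP/eqP => [/set2_inj[[_ E]|[E _]]|->] //.
      by rewrite -(Kx l) // -E Kx.
    by have := rx _ lm; rewrite -E eqxx.
  by rewrite (setUC [set x_ j]) !eqx ?cm.
have colN i j : i < m -> j < m -> cyc_color m i != cyc_color m j -> col (x_ i) != col (x_ j).
  have c4 k : cyc_color m k < 4 by rewrite /cyc_color; case: ifP; lia.
  move=> im jm; apply: contra => /eqP/(congr1 (@nat_of_ord 4)).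
  by rewrite /col !inordK ?c4 // !Kx // => ->.
exists P, col, id; split; rewrite ?SI.
- move=> v vN; have vm := cm _ (idx v vN).
  have := xN _ vm; rewrite NE => rx; have := vN; rewrite NE => rv; split.
    rewrite /gpath /= adj_sym rv rx /= !inE negb_or andbT -andbA.
    apply/and3P; split.
    + by apply: contraTneq rv => ->; rewrite adj_irrefl.
    + apply: contraTneq m2 => vx; have := Kx _ vm; rewrite -[x_ _]vx /cyc_next.
      by move: (idx v vN); case: ifP; lia.
    + by apply: contraTneq rx => <-; rewrite adj_irrefl.
  move=> x; rewrite !inE => /or3P[]/eqP->; rewrite ?eqxx ?rv ?orbT //.
  by rewrite rx orbT.
- move=> e v /edS[i im ->].
  have [vi|vi] := eqVneq (x_ i) v; last first.
    by exists (x_ i); rewrite xN // vi memP // /cyc_incident eqxx.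
  have [j [jm ji nj]] : exists j, [/\ j < m, j != i & cyc_next m j = i].
    by exists (if i == 0 then m.-1 else i.-1); rewrite /cyc_next; repeat case: ifP; split; lia.
  exists (x_ j); rewrite xN // memP // /cyc_incident nj eqxx orbT -vi.
  by split=> //; rewrite nth_uniq.
- move=> e1 e2 /edS[i im ->] /edS[j jm ->] ne.
  have ij : i != j by apply: contraNneq ne => ->.
  have [p [q [pm qm pq h1 h2]]] := cyc_color_separates m2 im jm ij.
  exists (x_ p), (x_ q); rewrite SI !xN // colN // !memP //.
- by move=> u uN; split=> //=; rewrite eqxx.
move=> v vN; rewrite (leq_add2r 3 _ 1) -(cards1 v).
apply: subset_leq_card; apply/subsetP => w /setIdP[_ /eqP->].
by rewrite set11.
Qed.

Lemma tree_system : connected T -> exists P col A, system r [set: T] P col A.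
Proof.
move=> cT; apply: (grow_ind (Q := fun S => exists P col A, system r S P col A) cT _
  (@linked_star T r)); last exact: star_system.
  by apply/set0Pn; exists r; rewrite setU11.
move=> S u l lS NS uS lNS ul [P [col [A sys]]].
apply: (system_grow acT lS _ uS lNS ul _ sys).
  by apply: (subsetP NS); rewrite setU11.
apply: contraNneq lNS => ur; apply: (subsetP NS).
by rewrite !inE -ur ul orbT.
Qed.

Lemma RSPS_tree k : connected T -> 4 <= k -> exists2 P : seq (seq T), RSPS k P & size P = #|T| - 1.
Proof.
move=> /tree_system[P [col [A [gP _ sep _ _]]]] k4.
set s := enum ([set: T] :\ r).
have sI v : (v \in s) = (v \in [set: T] :\ r) by rewrite mem_enum.
exists [seq P v | v <- s]; last first.
  by rewrite size_map -cardE -[in RHS]cardsT [in RHS](cardsD1 r) inE addKn.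
split; first by apply/allP => p /mapP[v]; rewrite sI => /gP[gv _] ->.
exists (fun i => widen_ord k4 (col (nth r s i))) => e1 e2 e1T e2T ne.
have inT e : e \in edges T -> e \in edges_in [set: T] by rewrite inE subsetT andbT.
have [v [w [vI wI vw /andP[h1 h2] /andP[h3 h4]]]] := sep _ _ (inT _ e1T) (inT _ e2T) ne.
rewrite -!sI in vI wI.
have iv : index v s < size [seq P v | v <- s] by rewrite size_map index_mem.
have iw : index w s < size [seq P v | v <- s] by rewrite size_map index_mem.
exists (Ordinal iv), (Ordinal iw) => /=.
by rewrite !(nth_map r) ?index_mem // !nth_index //; split.
Qed.

Lemma rsn_tree_le k : connected T -> 4 <= k -> rsn T k <= #|T| - 1.
Proof.
move=> cT k4; have [P rP <-] := RSPS_tree cT k4.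
by have [_] := rsnP T (ltnW (ltnW k4)); apply.
Qed.
End Star.

(** * The lower bound *)

Section Lower.
Variables (T : sgraph).
Implicit Types (v w c : T) (p : seq T).

(** A path has an end at [v] exactly when [nbrs_in p v] is a singleton, which
    makes the argument independent of the order in which [p] is traversed. *)
Definition nbrs_in p v := [set u | [set v; u] \in path_edges p].

Lemma card_path_ends p : gpath p -> \sum_v (#|nbrs_in p v| == 1) <= 2.
Proof.
move=> gp; rewrite -big_mkcond /= sum1_card.
case: p gp => [|x p] // gp.
apply: (@leq_trans #|[set x; last x p]|); last by rewrite cards2; case: (_ != _).
apply: subset_leq_card; apply/subsetP => v; rewrite unfold_in => /eqP/eqP/cards1P[u Nu].
have mem w : [set v; w] \in path_edges (x :: p) -> w = u.
  by move=> vw; apply/set1P; rewrite -Nu inE.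
have vp : v \in x :: p.
  have : u \in nbrs_in (x :: p) v by rewrite Nu set11.
  by rewrite inE => /path_edges_sub[].
have : endpoint (x :: p) v.
  apply/idPn => /(inner_edges gp vp)[a [b [ab /mem va /mem vb]]].
  by rewrite va vb eqxx in ab.
by rewrite /= !inE.
Qed.

Lemma count1_uniq (X : eqType) (a : pred X) (s : seq X) x y :
  count a s = 1 -> x \in s -> y \in s -> a x -> a y -> x = y.
Proof.
move=> c1 xs ys ax ay.
have : size (filter a s) = 1 by rewrite size_filter.
have : x \in filter a s by rewrite mem_filter ax.
have : y \in filter a s by rewrite mem_filter ay.
by case: filter => [|z [|? ?]] //; rewrite !inE => /eqP-> /eqP->.
Qed.

Lemma count_sum (X : Type) (a : pred X) (s : seq X) :
  count a s = \sum_(x <- s) a x.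
Proof. by rewrite -sum1_count big_mkcond. Qed.

Lemma subset2_eq (X : finType) (N : {set X}) a b : a != b -> N \subset [set a; b] ->
  [/\ (N == [set a]) = (a \in N) && (b \notin N),
      (N == [set b]) = (b \in N) && (a \notin N),
      (N == [set a; b]) = (a \in N) && (b \in N)
    & (#|N| == 1) = (a \in N) (+) (b \in N)].
Proof.
move=> ab NS.
have E : N = (if a \in N then [set a] else set0) :|: (if b \in N then [set b] else set0).
  apply/setP => x; rewrite in_setU; have [xN|xN] := boolP (x \in N).
    by have := subsetP NS x xN; rewrite in_set2 => /orP[]/eqP <-; rewrite xN set11 ?orbT.
  by apply/esym/norP; split; case: ifP => [yN|_]; rewrite ?inE //; apply: contraNneq xN => ->.
have sa : [set a] != [set b] by apply: contra_neq ab => /set1_inj.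
have n1 x : x \in [set a; b] -> [set x] != [set a; b].
  move=> _; apply/eqP => /(congr1 (fun A : {set X} => #|A|)).
  by rewrite cards1 cards2 ab.
have n0 (x : X) : set0 != [set x] by rewrite eq_sym -card_gt0 cards1.
have n02 : set0 != [set a; b] by rewrite eq_sym -card_gt0 cards2.
rewrite {1 4 7 10}E; case: (a \in N); case: (b \in N); rewrite ?setU0 ?set0U /=;
  rewrite ?eqxx ?cards1 ?cards2 ?cards0 ?ab ?(negPf sa) ?(negPf (n0 a)) ?(negPf (n0 b)) ?(negPf n02)
   ?(eq_sym [set b]) ?(negPf sa) ?(eq_sym [set a; b]) ?(negPf (n1 _ _)) ?inE ?eqxx ?orbT.
all: by split.
Qed.

Variables (P : seq (seq T)) (r : T).
Hypothesis gP : all (@gpath T) P.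
Hypothesis sepP : forall e1 e2, e1 \in edges T -> e2 \in edges T -> e1 != e2 ->
  exists2 p, p \in P & (e1 \in path_edges p) && (e2 \notin path_edges p).
Hypothesis dr : 3 <= degree r.

Definition ends v := \sum_(p <- P) (#|nbrs_in p v| == 1).
(** The paths that arrive at [v] along the edge [v c] and stop there. *)
Definition dart_ends v c := count (fun p => nbrs_in p v == [set c]) P.
Definition mult v c := count (fun p => [set v; c] \in path_edges p) P.
Definition lone v c : nat := mult v c == 1.

Lemma multC v c : mult v c = mult c v.
Proof. by rewrite /mult setUC. Qed.

(** Separation says something about an edge only when there is another edge. *)
Lemma another_edge e : exists2 e', e' \in edges T & e' != e.
Proof.
have : 1 < #|[set y | adj r y]| by apply: leq_trans dr.
case/card_gt1P => a [b [/[!inE] ra rb ab]].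
have [ea|ea] := eqVneq [set r; a] e; last by exists [set r; a]; rewrite ?mem_edges.
exists [set r; b]; rewrite ?mem_edges // -ea; apply: contra_neq ab.
by case/set2_inj => [[_ ->]|[-> ->]].
Qed.

Lemma mult_gt0 v c : adj v c -> 0 < mult v c.
Proof.
rewrite -mem_edges => ve; have [e e2 ne] := another_edge [set v; c].
rewrite eq_sym in ne; have [p pP /andP[vp _]] := sepP ve e2 ne.
by rewrite -has_count; apply/hasP; exists p.
Qed.

(** A path that is the only one through an edge has no other edge, since the two
    could not be separated; hence it ends on both sides of that edge. *)
Lemma lone_dart v c : adj v c -> lone v c <= dart_ends v c.
Proof.
move=> vc; rewrite /lone; case: eqP => //= m1.
have : 0 < mult v c by rewrite m1.
rewrite -!has_count => /hasP[p pP vp]; apply/hasP; exists p => //.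
apply/eqP/setP => u; rewrite !inE; apply/idP/eqP => [up|->//].
apply/eqP/idPn => uc.
have ue := gpath_edges (allP gP p pP) up.
rewrite -mem_edges in vc.
have ne : [set v; c] != [set v; u].
  by apply: contra_neq uc => /set2_inj[[_ ->]|[-> ->]].
have [p' p'P /andP[vp' up']] := sepP vc ue ne.
by rewrite -(count1_uniq m1 pP p'P vp vp') up in up'.
Qed.

Lemma sum_dart_ends v (D : {set T}) : \sum_(c in D) dart_ends v c <= ends v.
Proof.
rewrite /ends /dart_ends.
under eq_bigr do rewrite -sum1_count big_mkcond /=.
rewrite exchange_big /=; apply: leq_sum => p _.
rewrite -big_mkcondr /= sum1_card.
case: (eqVneq #|nbrs_in p v| 1) => [/eqP/cards1P[u ->]|ne] /=.
  rewrite -(cards1 u); apply: subset_leq_card; apply/subsetP => c.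
  by rewrite unfold_in => /andP[_ /eqP/set1_inj->]; rewrite set11.
rewrite leqn0; apply/eqP/eq_card0 => c; rewrite [LHS]unfold_in.
by apply/negP => /andP[_ /eqP E]; rewrite E cards1 in ne.
Qed.

Lemma nbrs_in_sub p v : p \in P -> nbrs_in p v \subset [set u | adj v u].
Proof.
move=> pP; apply/subsetP => u; rewrite !inE -mem_edges.
exact: gpath_edges (allP gP p pP).
Qed.

Lemma ends_leaf v a : [set u | adj v u] = [set a] -> ends v = mult v a.
Proof.
move=> Nv; rewrite /ends /mult -sum1_count [RHS]big_mkcond /=.
apply: eq_big_seq => p pP; have := nbrs_in_sub v pP; rewrite Nv subset1.
have -> : ([set v; a] \in path_edges p) = (a \in nbrs_in p v) by rewrite inE.
by case/orP => /eqP->; rewrite ?cards1 ?cards0 !inE ?eqxx.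
Qed.

(** Here [z] is the number of paths passing through [v]. *)
Lemma ends_deg2 v a b : a != b -> [set u | adj v u] = [set a; b] ->
  ends v = dart_ends v a + dart_ends v b /\
  exists z, mult v a = dart_ends v a + z /\ mult v b = dart_ends v b + z.
Proof.
move=> ab Nv; rewrite /ends /mult /dart_ends !count_sum.
have sub p : p \in P -> nbrs_in p v \subset [set a; b].
  by rewrite -Nv; exact: nbrs_in_sub.
have mem p u : ([set v; u] \in path_edges p) = (u \in nbrs_in p v) by rewrite inE.
split.
  rewrite -big_split /=; apply: eq_big_seq => p pP.
  have [-> -> _ ->] := subset2_eq ab (sub p pP).
  by case: (a \in _); case: (b \in _).
exists (\sum_(p <- P) (nbrs_in p v == [set a; b])); split;
  rewrite -big_split /=; apply: eq_big_seq => p pP; rewrite mem;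
  have [Ea Eb Eab _] := subset2_eq ab (sub p pP); rewrite ?Ea ?Eb Eab;
  by case: (a \in _); case: (b \in _).
Qed.

Lemma dart_ends_gt0 v a b : a != b -> [set u | adj v u] = [set a; b] ->
  0 < dart_ends v a.
Proof.
move=> ab Nv.
have [va vb] : adj v a /\ adj v b.
  by split; [have := set21 a b | have := set22 a b]; rewrite -Nv inE.
have ne : [set v; a] != [set v; b].
  by apply: contra_neq ab => /set2_inj[[_ ->]|[-> ->]].
rewrite -!mem_edges in va vb; have [p pP /andP[pa pb]] := sepP va vb ne.
rewrite -has_count; apply/hasP; exists p => //.
have Nab : nbrs_in p v \subset [set a; b] by rewrite -Nv nbrs_in_sub.
by have [-> _ _ _] := subset2_eq ab Nab; rewrite !inE pa pb.
Qed.

Variable par : T -> T.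
Hypothesis par_adj : forall v, v != r -> adj v (par v).
Hypothesis par_par : forall v, v != r -> par v != r -> par (par v) != v.

Definition children v := [set c | (c != r) && (par c == v)].

(** The debts are the terms [lone].  A vertex of degree at least 3 repays those
    of its children by [lone_dart].  At a vertex of degree 2 with a lone child
    edge, no path passes through, so either the parent edge is lone as well and
    takes over the debt, or two paths arrive along it and stop. *)
Lemma ends_local v :
  2 * (degree v <= 2) + \sum_(c in children v) lone v c
    <= ends v + (if v == r then 0 else lone v (par v)).
Proof.
have chN : children v \subset [set u | adj v u].
  apply/subsetP => c; rewrite !inE => /andP[cr /eqP <-].
  by rewrite adj_sym par_adj.
have [d3|d2] := ltnP 2 (degree v).
  rewrite muln0 add0n; apply: leq_trans (leq_addr _ _).
  apply: leq_trans (sum_dart_ends v (children v)); apply: leq_sum => c cv.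
  by apply: lone_dart; have := subsetP chN c cv; rewrite inE.
have vr : v != r by apply: contraTneq d2 => ->; rewrite -ltnNge.
rewrite (negPf vr).
have pN : par v \in [set u | adj v u] by rewrite inE par_adj.
have pC : par v \notin children v.
  apply/negP; rewrite inE => /andP[pr /eqP pp].
  by have := par_par vr pr; rewrite pp eqxx.
have chD : children v \subset [set u | adj v u] :\ par v.
  by rewrite subsetD1 chN.
have : #|[set u | adj v u]| = 1 \/ #|[set u | adj v u]| = 2.
  have : 0 < #|[set u | adj v u]| by apply/card_gt0P; exists (par v).
  by move: d2; rewrite /degree; case: #|_| => [|[|[|]]]; auto.
case=> [/eqP/cards1P[a Nv]|Nv].
  have pa : par v = a by apply/set1P; rewrite -Nv.
  have -> : children v = set0 by apply/eqP; rewrite -subset0; move: chD; rewrite Nv pa setDv.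
  rewrite big_set0 (ends_leaf Nv) pa /lone.
  have : 0 < mult v a by rewrite mult_gt0 // -pa par_adj.
  by case: (mult v a) => [|[|]].
have /cards1P[b Nb] : #|[set u | adj v u] :\ par v| == 1.
  by have := Nv; rewrite (cardsD1 (par v)) pN => /eqP.
set a := par v in Nb pN *.
have Nab : [set u | adj v u] = [set a; b] by rewrite -Nb setD1K.
have ab : a != b by have := set11 b; rewrite -Nb in_setD1 eq_sym => /andP[].
have [-> [z [ma mb]]] := ends_deg2 ab Nab.
have da := dart_ends_gt0 ab Nab.
have db : 0 < dart_ends v b by apply: (dart_ends_gt0 (b := a)); rewrite 1?eq_sym // setUC.
apply: (@leq_trans (2 + lone v b)); last by rewrite /lone ma mb; lia.
rewrite leq_add2l; rewrite Nb in chD.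
apply: leq_trans (_ : \sum_(c in [set b]) lone v c <= _); last by rewrite big_set1.
by rewrite [leqRHS](big_setID (children v)) /= (setIidPr chD) leq_addr.
Qed.

Lemma low_degree_le_size : #|[set v : T | degree v <= 2]| <= size P.
Proof.
have tot : \sum_v ends v <= 2 * size P.
  rewrite /ends exchange_big /= mul2n -addnn -!sum1_size -big_split /=.
  rewrite !big_seq; apply: leq_sum => p pP; exact: card_path_ends (allP gP p pP).
have : \sum_v (2 * (degree v <= 2) + \sum_(c in children v) lone v c)
    <= \sum_v (ends v + (if v == r then 0 else lone v (par v))).
  by apply: leq_sum => v _; exact: ends_local.
rewrite [leqRHS]big_split [leqLHS]big_split /=.
have -> : \sum_(v : T) 2 * (degree v <= 2) = 2 * #|[set v : T | degree v <= 2]|.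
  by rewrite -sum1_card big_distrr [RHS]big_mkcond; apply: eq_bigr => v _; rewrite inE; case: ifP.
have -> : \sum_(v : T) \sum_(c in children v) lone v c =
          \sum_v (if v == r then 0 else lone v (par v)).
  rewrite (exchange_big_dep xpredT) //=; apply: eq_bigr => c _.
  rewrite (eq_bigl (fun v => (c != r) && (par c == v))); last by move=> v; rewrite inE.
  case: eqP => /= [_|_]; first by rewrite big_pred0.
  by rewrite (big_pred1 (par c)) /lone 1?multC.
rewrite leq_add2r => h; rewrite -(leq_pmul2l (isT : 0 < 2)); exact: leq_trans h tot.
Qed.
End Lower.

(** The last clause keeps the parent of a vertex from being one of its children
    as well, so that at a vertex of degree 2 the two edges play different roles:
    debts come in along one and leave along the other. *)
Lemma parent_function (T : sgraph) (r : T) : connected T -> exists par : T -> T,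
  forall v, v != r -> adj v (par v) /\ (par v != r -> par (par v) != v).
Proof.
move=> cT.
have l1 : linked [set r] by move=> x y /set1P-> /set1P->; exact: connect0.
suff [par H] : exists par : T -> T, forall v, v \in [set: T] -> v != r ->
    [/\ par v \in [set: T], adj v (par v) & (par v != r -> par (par v) != v)].
  by exists par => v vr; have [] := H v (in_setT v) vr.
apply: (grow_ind (Q := fun S => exists par : T -> T, forall v, v \in S -> v != r ->
    [/\ par v \in S, adj v (par v) & (par v != r -> par (par v) != v)]) cT _ l1).
- by apply/set0Pn; exists r; rewrite set11.
- move=> S u l _ rS uS lNS ul [par H].
  exists (fun v => if v == l then u else par v) => v; rewrite !in_setU1.
  have uNl : u != l by apply: contraNneq lNS => <-.
  have [->|vl] /= := eqVneq v l => [_ lr|vS vr].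
    rewrite uS orbT (negPf uNl) adj_sym; split=> // ur.
    by have [pS _ _] := H u uS ur; apply: contraNneq lNS => <-.
  have [pS vp pp] := H v vS vr; rewrite pS orbT; split=> //.
  have [E|_] // := eqVneq (par v) l.
  by rewrite E (negPf lNS) in pS.
- by exists id => v /set1P ->; rewrite eqxx.
Qed.

Lemma rsn_ge_low_degree (T : sgraph) k (r : T) : 2 <= k -> connected T -> 3 <= degree r ->
  #|[set v : T | degree v <= 2]| <= rsn T k.
Proof.
move=> k2 cT dr; have [[P [gP [col sep]] <-] _] := rsnP T k2.
have [par H] := parent_function r cT.
apply: (@low_degree_le_size T P r gP _ dr par).
- move=> e1 e2 e1T e2T ne; have [i [j /= [_ h1 h2 _ _]]] := sep e1 e2 e1T e2T ne.
  by exists (nth [::] P i); rewrite ?mem_nth // h1 h2.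
- by move=> v /H[].
- by move=> v /H[].
Qed.

Theorem theorem3p7 (R : realType) :
  (forall T : sgraph, tree T -> ~ path_graph T ->
   forall k : nat, 4 <= k -> rsn T k <= #|T| - 1) /\
  (forall (I : Type) (Sigma : I -> sgraph), tree_class Sigma -> pathy R Sigma ->
   forall k : nat, 4 <= k -> forall eta : R, (0 < eta)%R ->
   exists N : nat, forall i : I,
     ~ path_graph (Sigma i) -> N <= #|Sigma i| ->
     (#|Sigma i|%:R - 1 - eta * #|Sigma i|%:R <= (rsn (Sigma i) k)%:R :> R)%R).
Proof.
split=> [T tT npT k k4|I Sigma [_ trees] path k k4 eta eta0].
  by have [r dr] := nonpath_branch tT npT; have [cT aT] := tT; exact: rsn_tree_le aT dr k cT k4.
have [N HN] := path eta eta0; exists N => i npi Ni.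
have [r dr] := nonpath_branch (trees i) npi.
have low := rsn_ge_low_degree (leq_trans (isT : 2 <= 4) k4) (trees i).1 dr.
have few := HN i Ni.
have card_split : #|Sigma i| = #|[set x : Sigma i | 3 <= degree x]|
                        + #|[set v : Sigma i | degree v <= 2]|.
  rewrite -(cardsC [set x : Sigma i | 3 <= degree x]); congr (_ + #|pred_of_set _|).
  by apply/setP => v; rewrite !inE -leqNgt.
have card_splitR : (#|Sigma i|%:R = #|[set x : Sigma i | (3 <= degree x)%N]|%:R
                        + #|[set v : Sigma i | (degree v <= 2)%N]|%:R :> R)%R.
  by rewrite [in LHS]card_split GRing.natrD.
have lowR : (#|[set v : Sigma i | (degree v <= 2)%N]|%:R <= (rsn (Sigma i) k)%:R :> R)%R.
  by rewrite Num.Theory.ler_nat.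
move: few lowR card_splitR; lra.
Qed.
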